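(* Suppose that $n$ is divisible by $4$. Then, letting $P_3$ denote the path with $3$ edges, \[ \mathrm{ex}^*(n,P_3)=\frac{3n}{2}=\frac32\,\mathrm{ex}(n,P_3)+O(1). \]
   Context: $\mathrm{ex}(n,F)$ is the usual Turán number: the maximum number of edges in an $n$-vertex graph containing no copy of $F$. $\mathrm{ex}^*(n,F)$ (the rainbow Turán number) is the maximum number of edges in an $n$-vertex graph that admits a proper edge-coloring containing no rainbow copy of $F$, i.e. no copy of $F$ all of whose edges receive different colors. *)

(* Defs.v *)
From HB Require Import structures.
From mathcomp Require Import all_boot all_order all_algebra.
From mathcomp Require Import boolp.

Set Implicit Arguments.
Unset Strict Implicit.
Unset Printing Implicit Defensive.

Record sgraph (V : finType) := SGraph {
  edges : {set {set V}};
  edges_card2 : [forall e in edges, #|e| == 2]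
}.

HB.instance Definition _ (V : finType) := [isSub for @edges V].
HB.instance Definition _ (V : finType) := [Finite of sgraph V by <:].

(* Copies are not required to be induced subgraphs. *)
Definition copy (W V : finType) (F : sgraph W) (G : sgraph V) (f : W -> V) : Prop :=
  injective f /\ (forall e : {set W}, e \in edges F -> f @: e \in edges G).

(* Only the values of a colouring on the edges of the graph matter. *)
Definition proper_coloring (V : finType) (G : sgraph V) (c : {set V} -> nat) : Prop :=
  forall e1 e2 : {set V}, e1 \in edges G -> e2 \in edges G ->
    e1 != e2 -> e1 :&: e2 != set0 -> c e1 != c e2.

Definition rainbow_copy (W V : finType) (F : sgraph W) (G : sgraph V)
    (c : {set V} -> nat) (f : W -> V) : Prop :=
  copy F G f /\ {in edges F &, injective (fun e : {set W} => c (f @: e))}.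

Definition turan_number (n : nat) (W : finType) (F : sgraph W) : nat :=
  \max_(G : sgraph 'I_n | `[< ~ exists f : W -> 'I_n, copy F G f >]) #|edges G|.

Definition rainbow_turan_number (n : nat) (W : finType) (F : sgraph W) : nat :=
  \max_(G : sgraph 'I_n |
        `[< exists c : {set 'I_n} -> nat, proper_coloring G c /\
              ~ exists f : W -> 'I_n, rainbow_copy F G c f >]) #|edges G|.

Definition path_edges (k : nat) : {set {set 'I_k.+1}} :=
  [set e | [exists x : 'I_k.+1, exists y : 'I_k.+1,
              (y == x.+1 :> nat) && (e == [set x; y])]].

Lemma path_edges_card2 (k : nat) : [forall e in path_edges k, #|e| == 2].
Proof.
apply/forall_inP => e; rewrite inE.
case/existsP => x /existsP[y] /andP[/eqP yx /eqP ->].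
by rewrite cards2 -val_eqE /= yx neq_ltn ltnSn.
Qed.

(* The path with k edges, hence k.+1 vertices. *)
Definition path_graph (k : nat) : sgraph 'I_k.+1 := SGraph (path_edges_card2 k).

(* Main.v *)
Require Import Defs.
From mathcomp Require Import all_boot all_order all_algebra.
From mathcomp Require Import boolp zify lra.
Import Order.TTheory GRing.Theory Num.Theory.
Local Open Scope ring_scope.

Set Implicit Arguments.
Unset Strict Implicit.
Unset Printing Implicit Defensive.

(* Upper bounds: if a vertex u of an edge uv has more than k neighbours (k = 2
   in the plain case, k = 3 in the rainbow case), a second edge at v would
   extend to a (rainbow) path x u v w, so v is a leaf.  Hence
   1/deg u + 1/deg v >= 2/k for every edge uv, and summing over all edges
   counts every vertex at most once, so that 2|E| <= k n.
   Lower bounds: a star for the plain case; for the rainbow case disjoint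
   copies of K_4, each coloured by its three perfect matchings: the end edges
   of a path with three edges form a perfect matching. *)

(** * Degrees, inverse-degree counting, and extending an edge to a path *)

Definition incident (V : finType) (G : sgraph V) (v : V) : {set {set V}} :=
  [set e in edges G | v \in e].

Definition deg (V : finType) (G : sgraph V) (v : V) : nat := #|incident G v|.

Section Graphs.
Variables (V : finType) (G : sgraph V).
Implicit Types (u v w x : V) (e g : {set V}).

Lemma card_edge e : e \in edges G -> #|e| = 2%N.
Proof. by move=> eG; have /forall_inP/(_ _ eG)/eqP := edges_card2 G. Qed.

Lemma edge_neq u v : [set u; v] \in edges G -> u != v.
Proof. by move/card_edge; rewrite cards2; case: (u != v). Qed.

Lemma edge_at e v : e \in edges G -> v \in e ->
  exists2 w, w != v & e = [set v; w].
Proof.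
move=> /card_edge/eqP/cards2P[a [b [ab ->]]]; rewrite !inE => /orP[]/eqP->.
  by exists b; rewrite // eq_sym.
by exists a; rewrite // setUC.
Qed.

Lemma deg_gt0 e v : e \in edges G -> v \in e -> (0 < deg G v)%N.
Proof. by move=> eG ve; apply/card_gt0P; exists e; rewrite inE eG. Qed.

Lemma edges_le_of_leaves k : (1 < k)%N ->
  (forall u v, [set u; v] \in edges G -> (k < deg G u)%N -> (deg G v <= 1)%N) ->
  (2 * #|edges G| <= k * #|V|)%N.
Proof.
move=> k1 leaf.
pose S : rat := \sum_(e in edges G) \sum_(v in e) (deg G v)%:R^-1.
have k0 : 0 < k%:R :> rat by rewrite ltr0n; lia.
have SV : S <= #|V|%:R.
  have -> : S = \sum_v \sum_(e in incident G v) (deg G v)%:R^-1.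
    rewrite /S (exchange_big_dep xpredT) //=.
    by apply: eq_bigr => v _; apply: eq_bigl => e; rewrite inE.
  rewrite -sum1_card natr_sum; apply: ler_sum => v _.
  rewrite sumr_const -/(deg G v) -[_ *+ _]mulr_natr.
  (* A vertex of positive degree collects exactly 1; an isolated one collects 0, its sum being
     empty. *)
  by case: (deg G v) => [|d]; rewrite ?mulr0 ?mulVf ?pnatr_eq0.
have inv_ge a : (0 < a <= k)%N -> 1 <= k%:R * a%:R^-1 :> rat.
  by case/andP=> a0 ak; rewrite ler_pdivlMr ?ltr0n // mul1r ler_nat.
have inv_ge0 (a : nat) : 0 <= k%:R * a%:R^-1 :> rat by rewrite mulr_ge0 ?invr_ge0.
have ES : 2 * #|edges G|%:R <= k%:R * S.
  rewrite /S mulr_sumr -sum1_card natr_sum mulr_sumr.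
  apply: ler_sum => e eG; rewrite mulr1.
  have /eqP/cards2P[a [b [ab eE]]] := card_edge eG.
  rewrite eE big_setU1 ?inE //= big_set1 mulrDr.
  have a0 : (0 < deg G a)%N by apply: (deg_gt0 eG); rewrite eE !inE eqxx.
  have b0 : (0 < deg G b)%N by apply: (deg_gt0 eG); rewrite eE !inE eqxx orbT.
  (* An edge with a leaf is paid for by the leaf alone, whose inverse degree is 1, because [k] is at
     least 2. *)
  have k2 : 2 <= k%:R :> rat by rewrite ler_nat.
  move: eG; rewrite eE => eG.
  have [ka|ak] := ltnP k (deg G a).
    have -> : deg G b = 1%N by have := leaf _ _ eG ka; lia.
    by rewrite invr1 mulr1; have := inv_ge0 (deg G a); lra.
  have [kb|bk] := ltnP k (deg G b).
    rewrite setUC in eG.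
    have -> : deg G a = 1%N by have := leaf _ _ eG kb; lia.
    by rewrite invr1 mulr1; have := inv_ge0 (deg G b); lra.
  have := inv_ge (deg G a); have := inv_ge (deg G b).
  by rewrite a0 ak b0 bk => /(_ isT) + /(_ isT); lra.
rewrite -(ler_nat rat) !natrM; apply: le_trans ES _.
by rewrite ler_pM2l.
Qed.

(** Serves both the plain and the rainbow case: [bad g] holds the edges forbidden as first edge once
    [g] is the last one. The last edge is picked first, as a second edge at [v]; the first edge then
    has to avoid at most [m + 2] edges at [u]. *)
Lemma path_through_edge (bad : {set V} -> {set {set V}}) m u v :
  (forall g, (#|bad g| <= m)%N) ->
  [set u; v] \in edges G -> (m.+2 < deg G u)%N -> (1 < deg G v)%N ->
  exists x w, [/\ uniq [:: x; u; v; w], [set x; u] \in edges G,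
    [set v; w] \in edges G & [set x; u] \notin bad [set v; w]].
Proof.
move=> badm uv du dv.
have neq_uv := edge_neq uv.
have [g] : exists g, g \in incident G v :\ [set u; v].
  apply/card_gt0P; rewrite -ltnS; apply: leq_trans dv _.
  by rewrite /deg (cardsD1 [set u; v]); case: (_ \in _).
rewrite !inE => /and3P[g_uv gG vg].
have [w wv gE] := edge_at gG vg.
have wu : w != u by apply: contraNneq g_uv => <-; rewrite gE setUC.
(* Avoiding [[set u; v]] gives [x != v], and avoiding [[set u; w]] gives [x != w]. *)
set A := [set [set u; v]; [set u; w]] :|: bad g.
have [h] : exists h, h \in incident G u :\: A.
  apply/card_gt0P; rewrite cardsD subn_gt0.
  apply: leq_ltn_trans (subset_leq_card (subsetIr _ _)) _.
  apply: leq_ltn_trans (leq_card_setU _ _) _.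
  apply: leq_ltn_trans du; rewrite -add2n; apply: leq_add (badm g).
  by rewrite cards2; case: (_ != _).
rewrite !inE !negb_or => /and3P[/andP[/andP[h_uv h_uw] h_bad] hG uh].
have [x xu hE] := edge_at hG uh.
have xv : x != v by apply: contraNneq h_uv => <-; rewrite hE.
have xw : x != w by apply: contraNneq h_uw => <-; rewrite hE.
exists x, w; rewrite setUC -hE -gE; split=> //=.
by rewrite !inE !negb_or xu xv xw neq_uv (eq_sym u w) wu (eq_sym v w) wv.
Qed.

End Graphs.

(** * Copies of the three-edge path as quadruples of vertices *)

Lemma enum_I4 : enum 'I_4 = [:: inord 0; inord 1; inord 2; inord 3].
Proof. by apply: (inj_map val_inj); rewrite val_enum_ord /= !inordK. Qed.

Lemma uniq_path3_edges (V : finType) (x u v w : V) : uniq [:: x; u; v; w] ->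
  uniq [:: [set x; u]; [set u; v]; [set v; w]].
Proof.
rewrite /= !inE !negb_or !andbT.
case/and3P=> /and3P[xu xv xw] /andP[uv uw] vw.
have neq (y : V) (e g : {set V}) : y \in e -> y \notin g -> e != g.
  by move=> ye; apply: contraNneq => <-.
(* The vertex [x] lies on the first edge only, and [u] is missing from the third. *)
apply/andP; split; first (apply/andP; split);
  [apply: (neq x)|apply: (neq x)|apply: (neq u)];
  by rewrite !inE ?eqxx // negb_or; apply/andP.
Qed.

Definition path3_edges : seq {set 'I_4} :=
  [:: [set inord 0; inord 1]; [set inord 1; inord 2]; [set inord 2; inord 3]].

Lemma mem_path3_edges : edges (path_graph 3) =i path3_edges.
Proof.
move=> e; rewrite !inE; apply/existsP/idP.
  case=> x /existsP[y /andP[/eqP yx /eqP->]].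
  have := ltn_ord y; rewrite -(inord_val x) -[in [set _; y]](inord_val y) yx.
  by case: (val x) => [|[|[|k]]]; rewrite ?eqxx ?orbT.
by case/or3P=> /eqP->; [exists (inord 0)|exists (inord 1)|exists (inord 2)];
  apply/existsP; [exists (inord 1)|exists (inord 2)|exists (inord 3)];
  rewrite !inordK ?eqxx.
Qed.

Lemma map_path3_edges (V : finType) (f : 'I_4 -> V) :
  [seq f @: e | e : {set 'I_4} <- path3_edges] =
  [:: [set f (inord 0); f (inord 1)]; [set f (inord 1); f (inord 2)];
      [set f (inord 2); f (inord 3)]].
Proof. by rewrite /= !imsetU1 !imset_set1. Qed.

(** Injectivity, on vertices and on edge colours, becomes [uniq] of explicit lists, which can be
    computed for a concrete path. *)
Lemma rainbow_copy_path3P (V : finType) (G : sgraph V) c (f : 'I_4 -> V) :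
  let s := [seq f @: e | e : {set 'I_4} <- path3_edges] in
  rainbow_copy (path_graph 3) G c f <->
  [/\ uniq [seq f i | i <- enum 'I_4], {subset s <= edges G} & uniq (map c s)].
Proof.
have Up : uniq path3_edges by rewrite uniq_path3_edges // -enum_I4 enum_uniq.
have p3 : perm_eq (enum (edges (path_graph 3))) path3_edges.
  by apply: uniq_perm; rewrite ?enum_uniq // => e; rewrite mem_enum mem_path3_edges.
move=> s.
have -> : uniq (map c s) =
    uniq [seq c (f @: e) | e : {set 'I_4} <- enum (edges (path_graph 3))].
  rewrite /s -map_comp; apply: perm_uniq.
  by rewrite perm_sym; apply: (perm_map (T2 := nat)).
split=> [[[/injectiveP fI fG] /dinjectiveP cI]|[/injectiveP fI fG /dinjectiveP cI]].
  split=> // _ /mapP[e ep ->]; apply: fG.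
  by rewrite mem_path3_edges.
do ![split=> //] => e; rewrite mem_path3_edges => ep.
exact/fG/map_f.
Qed.

Lemma rainbow_path3P (V : finType) (G : sgraph V) (c : {set V} -> nat) :
  (exists f, rainbow_copy (path_graph 3) G c f) <->
  exists x u v w, let s := [:: [set x; u]; [set u; v]; [set v; w]] in
    [/\ uniq [:: x; u; v; w], {subset s <= edges G} & uniq (map c s)].
Proof.
split=> [[f /rainbow_copy_path3P]|[x [u [v [w sP]]]]].
  rewrite map_path3_edges enum_I4 => fP.
  by exists (f (inord 0)), (f (inord 1)), (f (inord 2)), (f (inord 3)).
exists (fun i : 'I_4 => nth x [:: x; u; v; w] i); apply/rainbow_copy_path3P.
by rewrite map_path3_edges enum_I4 /= !inordK.
Qed.

(** Reduces to the rainbow case: under an injective colouring every copy is rainbow. *)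
Lemma copy_path3P (V : finType) (G : sgraph V) :
  (exists f, copy (path_graph 3) G f) <->
  exists x u v w, uniq [:: x; u; v; w] /\
    {subset [:: [set x; u]; [set u; v]; [set v; w]] <= edges G}.
Proof.
pose c (e : {set V}) : nat := enum_rank e.
have cI : injective c by move=> e g /val_inj/enum_rank_inj.
have [rc cr] := rainbow_path3P G c.
split=> [[f fP]|[x [u [v [w [Uxs Gxs]]]]]].
  have [|x [u [v [w [? ? _]]]]] := rc; last by exists x, u, v, w.
  have [fI _] := fP.
  by exists f; split=> // e g _ _ /cI; apply: imset_inj.
have [|f [fP _]] := cr; last by exists f.
exists x, u, v, w; split=> //.
by have := uniq_path3_edges Uxs; rewrite -(map_inj_uniq cI).
Qed.

(** * Upper bounds on the number of edges *)

Section UpperBounds.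
Variables (V : finType) (G : sgraph V).

Lemma path3_free_edges :
  (~ exists f, copy (path_graph 3) G f) -> (#|edges G| <= #|V|)%N.
Proof.
move=> noP3; rewrite -(leq_pmul2l (isT : 0 < 2)%N).
apply: edges_le_of_leaves => // u v uv du; rewrite leqNgt; apply/negP => dv.
(* Without colours no first edge is forbidden, so [m = 0] and degree above 2 suffices. *)
pose bad (g : {set V}) : {set {set V}} := set0.
have bad0 g : (#|bad g| <= 0)%N by rewrite cards0.
have [x [w [Uxs xu vw _]]] := path_through_edge bad0 uv du dv.
apply/noP3/copy_path3P; exists x, u, v, w; split=> // e.
by rewrite !inE => /or3P[] /eqP->.
Qed.

Lemma rainbow_path3_free_edges (c : {set V} -> nat) : proper_coloring G c ->
  (~ exists f, rainbow_copy (path_graph 3) G c f) ->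
  (2 * #|edges G| <= 3 * #|V|)%N.
Proof.
move=> cP noP3.
apply: edges_le_of_leaves => // u v uv du; rewrite leqNgt; apply/negP => dv.
(* The edges at [u] coloured like [g]: two of them would meet at [u] with equal colours, so there is
   at most one, and degree above 3 suffices. *)
pose bad g := [set h in incident G u | c h == c g].
have bad1 g : (#|bad g| <= 1)%N.
  apply/card_le1_eqP => h1 h2.
  rewrite !inE => /andP[/andP[h1G uh1] /eqP c1] /andP[/andP[h2G uh2] /eqP c2].
  apply/eqP/negPn/negP => h21.
  have h0 : h2 :&: h1 != set0 by apply/set0Pn; exists u; rewrite inE uh2.
  by have := cP _ _ h2G h1G h21 h0; rewrite c1 c2 eqxx.
have [x [w [Uxs xu vw]]] := path_through_edge bad1 uv du dv.
rewrite !inE xu eqxx orbT /= => cxw.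
apply/noP3/rainbow_path3P; exists x, u, v, w; split=> // [e|].
  by rewrite !inE => /or3P[] /eqP->.
have := uniq_path3_edges Uxs.
rewrite /= !inE !negb_or cxw !andbT => /andP[/andP[n12 _] n23].
(* Consecutive edges share [u] or [v], so properness separates their colours; the two end edges were
   handled by [cxw]. *)
apply/andP; split; apply: cP => //; apply/set0Pn; [exists u|exists v];
  by rewrite !inE eqxx orbT.
Qed.

End UpperBounds.

(** * Lower bound for the plain case: the star *)

Section Star.
Variable n : nat.

Definition star_edges : {set {set 'I_n.+1}} :=
  [set [set ord0; x] | x in [set~ ord0]].

Lemma star_card2 : [forall e in star_edges, #|e| == 2].
Proof.
apply/forall_inP => e /imsetP[x]; rewrite !inE => x0 ->.
by rewrite cards2 (eq_sym ord0) x0.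
Qed.

Definition star : sgraph 'I_n.+1 := SGraph star_card2.

Lemma card_star : #|edges star| = n.
Proof.
rewrite card_in_imset => [|x y]; first by rewrite cardsC1 card_ord.
rewrite !inE => x0 _ /setP/(_ x); rewrite !inE eqxx orbT (negPf x0) /=.
by move/esym/eqP.
Qed.

(** The two end edges of the path are disjoint, whereas all edges of the star share [ord0]. *)
Lemma star_path3_free : ~ exists f, copy (path_graph 3) star f.
Proof.
case/copy_path3P=> x [u [v [w [Uxs Gxs]]]].
have center e : e \in star_edges -> ord0 \in e.
  by case/imsetP=> y _ ->; rewrite !inE eqxx.
have xu : ord0 \in [set x; u] by apply/center/Gxs; rewrite !inE eqxx.
have vw : ord0 \in [set v; w] by apply/center/Gxs; rewrite !inE eqxx !orbT.
move: Uxs xu vw; rewrite /= !inE !negb_or => /and4P[/and3P[_ xv xw] /andP[uv uw] _ _].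
by do 2![case/orP=> /eqP ?]; subst; rewrite eqxx in xv xw uv uw.
Qed.

End Star.

(** * Lower bound for the rainbow case: disjoint copies of K_4 *)

Section DisjointK4.
Variable m : nat.
Implicit Types x y : 'I_(m * 4).

(** The disjoint union of [m] copies of K_4: the quotient by 4 names the copy, the remainder the
    vertex within it. *)
Definition k4s_edges : {set {set 'I_(m * 4)}} :=
  [set e : {set 'I_(m * 4)} | (#|e| == 2) &&
     [forall x in e, forall y in e, (x %/ 4 == y %/ 4)%N]].

Lemma k4s_card2 : [forall e in k4s_edges, #|e| == 2].
Proof. by apply/forall_inP => e; rewrite inE => /andP[]. Qed.

Definition k4s : sgraph 'I_(m * 4) := SGraph k4s_card2.

Lemma k4s_edge x y : [set x; y] \in edges k4s -> (x %/ 4 = y %/ 4)%N.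
Proof.
rewrite inE => /andP[_ /forall_inP/(_ x)]; rewrite !inE eqxx => /(_ isT).
by move=> /forall_inP/(_ y); rewrite !inE eqxx orbT => /(_ isT)/eqP.
Qed.

Lemma mod4_neq x y : x != y -> (x %/ 4 = y %/ 4)%N -> (x %% 4 != y %% 4)%N.
Proof.
move=> xy eq4; apply: contraNneq xy => eqm.
by apply/eqP/val_inj; rewrite /= (divn_eq x 4) (divn_eq y 4) eq4 eqm.
Qed.

Fact k4s_vertex_subproof (q : 'I_m) (i : 'I_4) : (q * 4 + i < m * 4)%N.
Proof. by have := ltn_ord q; have := ltn_ord i; lia. Qed.

Definition k4s_vertex q i : 'I_(m * 4) := Ordinal (k4s_vertex_subproof q i).

Lemma k4s_vertex_div q i : (k4s_vertex q i %/ 4 = q)%N.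
Proof. by rewrite divnMDl // divn_small ?addn0. Qed.

Lemma k4s_vertex_inj q : injective (k4s_vertex q).
Proof. by move=> i j /(congr1 val)/= /addnI/val_inj. Qed.

(** Each of the [m] copies contributes the binomial number C(4,2) = 6, through an injection from
    pairs of a copy and a 2-subset of ['I_4]. *)
Lemma card_k4s : (m * 6 <= #|edges k4s|)%N.
Proof.
pose D := [set p : 'I_m * {set 'I_4} | #|p.2| == 2].
pose f (p : 'I_m * {set 'I_4}) := k4s_vertex p.1 @: p.2.
have fI : {in D &, injective f}.
  move=> [q P] [q' P']; rewrite !inE /= /f /= => /eqP P2 _ eqf.
  (* Any vertex of the image reveals its copy, by its quotient by 4; nonemptiness of [P] supplies
     one. *)
  have /card_gt0P[i iP] : (0 < #|P|)%N by rewrite P2.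
  have /imsetP[j _ eqv] : k4s_vertex q i \in k4s_vertex q' @: P'.
    by rewrite -eqf imset_f.
  have eq_q : q = q'.
    by apply: val_inj; rewrite /= -(k4s_vertex_div q i) eqv k4s_vertex_div.
  by congr (_, _) => //; apply: (imset_inj (@k4s_vertex_inj q)); rewrite eqf eq_q.
have -> : (m * 6)%N = #|D|.
  have -> : D = setX setT [set P : {set 'I_4} | #|P| == 2].
    by apply/setP=> p; rewrite !inE.
  by rewrite cardsX cardsT card_draws !card_ord.
rewrite -(card_in_imset fI); apply/subset_leq_card/subsetP => _ /imsetP[[q P] + ->].
rewrite !inE /f /= card_imset; last exact: k4s_vertex_inj.
move=> ->; apply/forall_inP => _ /imsetP[i _ ->]; apply/forall_inP => _ /imsetP[j _ ->].
by rewrite !k4s_vertex_div.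
Qed.

(* For pairs in {0, 1, 2, 3} with sums s and t, maxn s (6 - s) = maxn t (6 - t)
   exactly when the pairs are equal or complementary. *)
Definition matching_coloring (e : {set 'I_(m * 4)}) : nat :=
  let s := (\sum_(x in e) x %% 4)%N in maxn s (6 - s).

Lemma matching_coloring2 x y : x != y ->
  matching_coloring [set x; y] = maxn (x %% 4 + y %% 4) (6 - (x %% 4 + y %% 4)).
Proof. by move=> xy; rewrite /matching_coloring big_setU1 ?inE //= big_set1. Qed.

(** Two distinct edges at [v] are neither equal nor complementary within their K_4, so they belong
    to different perfect matchings. *)
Lemma matching_coloring_proper : proper_coloring k4s matching_coloring.
Proof.
move=> e1 e2 e1G e2G e12 /set0Pn[v]; rewrite inE => /andP[v1 v2].
have [a av e1E] := edge_at e1G v1; have [b bv e2E] := edge_at e2G v2.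
rewrite e1E e2E in e1G e2G e12 *.
have va := k4s_edge e1G; have vb := k4s_edge e2G.
have nva := edge_neq e1G; have nvb := edge_neq e2G.
have ab : a != b by apply: contraNneq e12 => ->.
have := mod4_neq ab (etrans (esym va) vb).
have := mod4_neq nva va; have := mod4_neq nvb vb.
rewrite !matching_coloring2 //.
have := ltn_pmod v (isT : 0 < 4)%N; have := ltn_pmod a (isT : 0 < 4)%N.
have := ltn_pmod b (isT : 0 < 4)%N; lia.
Qed.

(** A path stays in one K_4 and uses all four residues, whose sum is 6. The end edges thus have
    residue sums s and 6 - s, hence the same colour. *)
Lemma k4s_rainbow_path3_free :
  ~ exists f, rainbow_copy (path_graph 3) k4s matching_coloring f.
Proof.
case/rainbow_path3P=> x [u [v [w [Uxs Gxs Uc]]]].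
have bxu : (x %/ 4 = u %/ 4)%N by apply/k4s_edge/Gxs; rewrite !inE eqxx.
have buv : (u %/ 4 = v %/ 4)%N by apply/k4s_edge/Gxs; rewrite !inE eqxx orbT.
have bvw : (v %/ 4 = w %/ 4)%N by apply/k4s_edge/Gxs; rewrite !inE eqxx !orbT.
move: Uxs; rewrite /= !inE !negb_or.
case/and4P=> /and3P[xu xv xw] /andP[uv uw] vw _.
suff c13 : matching_coloring [set x; u] = matching_coloring [set v; w].
  by move: Uc; rewrite /= !inE c13 eqxx orbT.
rewrite !matching_coloring2 //.
have mxu := mod4_neq xu bxu; have mxv := mod4_neq xv (etrans bxu buv).
have mxw := mod4_neq xw (etrans bxu (etrans buv bvw)).
have muv := mod4_neq uv buv; have muw := mod4_neq uw (etrans buv bvw).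
have mvw := mod4_neq vw bvw.
have := ltn_pmod x (isT : 0 < 4)%N; have := ltn_pmod u (isT : 0 < 4)%N.
have := ltn_pmod v (isT : 0 < 4)%N; have := ltn_pmod w (isT : 0 < 4)%N; lia.
Qed.

End DisjointK4.

(** * Values of the two extremal numbers *)

Lemma turan_number_path3_le n : (turan_number n (path_graph 3) <= n)%N.
Proof.
apply/bigmax_leqP => G /asboolP/path3_free_edges.
by rewrite card_ord.
Qed.

Lemma turan_number_path3_ge n : (n <= (turan_number n (path_graph 3)).+1)%N.
Proof.
(* The star on [n.+1] vertices has [n] edges, one fewer than its vertices: hence the successor in
   the bound. *)
case: n => // n; rewrite ltnS -[X in (X <= _)%N]card_star.
by apply: leq_bigmax_cond; apply/asboolP/star_path3_free.
Qed.

Lemma rainbow_turan_number_path3 m :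
  rainbow_turan_number (m * 4) (path_graph 3) = (m * 6)%N.
Proof.
apply/eqP; rewrite eqn_leq; apply/andP; split.
  apply/bigmax_leqP => G /asboolP[c [cP noP3]].
  by have := rainbow_path3_free_edges cP noP3; rewrite card_ord; lia.
apply: leq_trans (card_k4s m) _; apply: leq_bigmax_cond; apply/asboolP.
exists (@matching_coloring m); split; first exact: matching_coloring_proper.
exact: k4s_rainbow_path3_free.
Qed.

Theorem theorem10 :
  exists C : rat, forall n : nat, (4 %| n)%N ->
    (rainbow_turan_number n (path_graph 3))%:R = 3%:R * n%:R / 2%:R :> rat /\
    `| 3%:R * n%:R / 2%:R - 3%:R / 2%:R * (turan_number n (path_graph 3))%:R | <= C.
Proof.
(* The plain Turán number lies between n - 1 and n, so the error is at most 3/2 times 1. *)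
exists (3%:R / 2%:R) => n /dvdnP[m ->]; split.
  by rewrite rainbow_turan_number_path3 !natrM; lra.
have := turan_number_path3_le (m * 4); have := turan_number_path3_ge (m * 4).
rewrite -!(ler_nat rat) -natr1 => ge le.
by rewrite ler_norml; apply/andP; split; lra.
Qed.
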